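(* Let $\mathcal{C}$ and $\mathcal{D}$ be $J$-categories in which all objects are cofibrant models. If $\mu:\mathcal{C}\to\mathcal{D}$ is a modelization functor, then for any morphism $p:E\to B$ of $\mathcal{C}$, $$\mathrm{secat}(\mu(p))\le\mathrm{secat}(p).$$
   Context: **$J$-category.** A $J$-category $\mathcal{C}$ is a category with a zero object $0$ and three classes of morphisms, called fibrations, cofibrations and weak equivalences, satisfying (J1)-(J5) below. A trivial fibration (resp. trivial cofibration) is a fibration (resp. cofibration) that is also a weak equivalence. An object $B$ is a cofibrant model if every trivial fibration $E\to B$ admits a section. (J1) Isomorphisms are trivial cofibrations and trivial fibrations. Fibrations and cofibrations are closed under composition. If two of $f,g,gf$ are weak equivalences, so is the third. (J2) The pullback of a fibration $p:E\to B$ along any morphism $f:B'\to B$ exists, with projections $\overline p:E'\to B'$ and $\overline f:E'\to E$, and $\overline p$ is a fibration; if $f$ (resp. $p$) is a weak equivalence, so is $\overline f$ (resp. $\overline p$). The dual statement (pushouts of cofibrations) also holds. (J3) Every morphism $f$ has an $F$-factorization $f=p\tau$ ($\tau$ a weak equivalence, $p$ a fibration) and a $C$-factorization $f=\sigma i$ ($i$ a cofibration, $\sigma$ a weak equivalence). (J4) For every object $X$ there is a trivial fibration $\overline X\to X$ with $\overline X$ a cofibrant model. (J5) (Cube axiom) In any commutative cube whose bottom face is a homotopy pushout and whose vertical faces are homotopy pullbacks, the top face is a homotopy pushout. Here a commutative square with maps $D\to C$, $D\to A$, $g:C\to B$, $f:A\to B$ is a homotopy pullback if for some (equivalently any) $F$-factorization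 $C\to E\to B$ of $g$ the induced morphism $D\to A\times_B E$ is a weak equivalence. Homotopy pushouts are defined dually. **Modelization functor.** A (covariant) functor $\mu:\mathcal{C}\to\mathcal{D}$ between categories satisfying (J1)-(J4) is a modelization functor if it preserves weak equivalences, homotopy pullbacks and homotopy pushouts. **Join.** Given $f:A\to B$ and $g:C\to B$, choose an $F$-factorization $g=p\tau$, $p:E\to B$; form the pullback $E'=A\times_B E$ with projections $\overline p:E'\to A$, $\overline f:E'\to E$; choose a $C$-factorization $\overline f=\sigma i$, $i:E'\to Z$, $\sigma: Z\to E$; let $A*_BC$ be the pushout of $\overline p$ and $i$. The join morphism of $f$ and $g$ is the morphism $A*_BC\to B$ induced by $f:A\to B$ and $p\sigma:Z\to B$. It is well defined up to weak equivalence. **Weak lifting and weak section** (all objects being cofibrant models). $f:A\to B$ admits a weak lifting along $g:C\to B$ if for some (equivalently any) $F$-factorization $g=p\tau$, with $p:E\to B$, there is $s:A\to E$ with $ps=f$. A morphism $g:C\to B$ admits a weak section if $\mathrm{id}_B$ admits a weak lifting along $g$. **Sectional category.** For $p:E\to B$ define inductively $h_n:*^n_BE\to B$: $h_0=p$ (so $*^0_BE=E$), and $h_n$ is the join morphism of $h_{n-1}:*^{n-1}_BE\to B$ and $p:E\to B$ (with $*^n_BE=( *^{n-1}_BE)*_BE$). $\mathrm{secat}(p)$ is the least integer $n\ge 0$ such that $h_n$ admits a weak section, and $\infty$ if there is no such $n$. (An equivalent Whitehead-type definition exists.) *)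

(* Defs.v *)
From mathcomp Require Import all_boot.
From mathcomp Require Import boolp.

Set Implicit Arguments.
Unset Strict Implicit.
Unset Printing Implicit Defensive.

Declare Scope cat_scope.
Delimit Scope cat_scope with cat.
Local Open Scope cat_scope.

Reserved Notation "X ~> Y" (at level 99, Y at level 200).

Record category := Category {
  ob :> Type;
  hom : ob -> ob -> Type;
  idm : forall X, hom X X;
  compm : forall X Y Z, hom Y Z -> hom X Y -> hom X Z;
  comp_idl : forall X Y (f : hom X Y), compm (idm Y) f = f;
  comp_idr : forall X Y (f : hom X Y), compm f (idm X) = f;
  comp_assoc : forall X Y Z T (h : hom Z T) (g : hom Y Z) (f : hom X Y),
    compm h (compm g f) = compm (compm h g) f }.

Notation "X ~> Y" := (hom X Y) : type_scope.
Notation "g \o f" := (compm g f) : cat_scope.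

Record functor (C D : category) := Functor {
  fob :> C -> D;
  fmap : forall X Y : C, (X ~> Y) -> (fob X ~> fob Y);
  fmap_id : forall X : C, fmap (idm X) = idm (fob X);
  fmap_comp : forall (X Y Z : C) (g : Y ~> Z) (f : X ~> Y),
    fmap (g \o f) = fmap g \o fmap f }.

Section Category.
Variable C : category.

Definition is_iso (X Y : C) (f : X ~> Y) : Prop :=
  exists g : Y ~> X, g \o f = idm X /\ f \o g = idm Y.

Definition is_zero (Z : C) : Prop :=
  forall X : C, (exists! f : X ~> Z, True) /\ (exists! f : Z ~> X, True).

Definition is_pullback (A B E P : C) (f : A ~> B) (p : E ~> B)
    (p1 : P ~> A) (p2 : P ~> E) : Prop :=
  f \o p1 = p \o p2 /\
  forall (X : C) (x1 : X ~> A) (x2 : X ~> E), f \o x1 = p \o x2 ->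
    exists! u : X ~> P, p1 \o u = x1 /\ p2 \o u = x2.

Definition is_pushout (A D Z P : C) (f : D ~> A) (i : D ~> Z)
    (i1 : A ~> P) (i2 : Z ~> P) : Prop :=
  i1 \o f = i2 \o i /\
  forall (X : C) (x1 : A ~> X) (x2 : Z ~> X), x1 \o f = x2 \o i ->
    exists! u : P ~> X, u \o i1 = x1 /\ u \o i2 = x2.

End Category.

Record modelData := ModelData {
  model_cat :> category;
  fib : forall X Y : model_cat, (X ~> Y) -> Prop;
  cof : forall X Y : model_cat, (X ~> Y) -> Prop;
  weq : forall X Y : model_cat, (X ~> Y) -> Prop }.

Section ModelData.
Variable C : modelData.

Definition trivial_fib (X Y : C) (f : X ~> Y) : Prop := fib f /\ weq f.

Definition trivial_cof (X Y : C) (f : X ~> Y) : Prop := cof f /\ weq f.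

Definition cofibrant_model (B : C) : Prop :=
  forall (E : C) (p : E ~> B), trivial_fib p ->
    exists s : B ~> E, p \o s = idm B.

Definition F_factorization (X Y E : C) (f : X ~> Y)
    (tau : X ~> E) (p : E ~> Y) : Prop :=
  [/\ f = p \o tau, weq tau & fib p].

Definition C_factorization (X Y Z : C) (f : X ~> Y)
    (i : X ~> Z) (sigma : Z ~> Y) : Prop :=
  [/\ f = sigma \o i, cof i & weq sigma].

(* The square is
       D --d--> C'
       |v       |g
       A --f--> B                                                        *)
Definition homotopy_pullback (D C' A B : C) (d : D ~> C') (v : D ~> A)
    (g : C' ~> B) (f : A ~> B) : Prop :=
  g \o d = f \o v /\
  exists (E : C) (tau : C' ~> E) (p : E ~> B), F_factorization g tau p /\
  exists (P : C) (p1 : P ~> A) (p2 : P ~> E), is_pullback f p p1 p2 /\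
  exists w : D ~> P, [/\ p1 \o w = v, p2 \o w = tau \o d & weq w].

(* Same square, same order of arguments; here it is d that is replaced by a
   cofibration. *)
Definition homotopy_pushout (D C' A B : C) (d : D ~> C') (v : D ~> A)
    (g : C' ~> B) (f : A ~> B) : Prop :=
  g \o d = f \o v /\
  exists (Z : C) (i : D ~> Z) (sigma : Z ~> C'), C_factorization d i sigma /\
  exists (P : C) (i1 : A ~> P) (i2 : Z ~> P), is_pushout v i i1 i2 /\
  exists w : P ~> B, [/\ w \o i1 = f, w \o i2 = g \o sigma & weq w].

Definition J1 : Prop :=
  [/\ forall (X Y : C) (f : X ~> Y), is_iso f -> trivial_cof f /\ trivial_fib f,
      forall (X Y Z : C) (g : Y ~> Z) (f : X ~> Y),
        fib g -> fib f -> fib (g \o f),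
      forall (X Y Z : C) (g : Y ~> Z) (f : X ~> Y),
        cof g -> cof f -> cof (g \o f)
    & forall (X Y Z : C) (g : Y ~> Z) (f : X ~> Y),
        [/\ weq f -> weq g -> weq (g \o f),
            weq f -> weq (g \o f) -> weq g
          & weq g -> weq (g \o f) -> weq f]].

Definition J2_pullback : Prop :=
  forall (E B B' : C) (p : E ~> B) (f : B' ~> B), fib p ->
    (exists (E' : C) (p' : E' ~> B') (f' : E' ~> E), is_pullback f p p' f') /\
    (forall (E' : C) (p' : E' ~> B') (f' : E' ~> E), is_pullback f p p' f' ->
       [/\ fib p', weq f -> weq f' & weq p -> weq p']).

Definition J2_pushout : Prop :=
  forall (E B B' : C) (i : B ~> E) (f : B ~> B'), cof i ->
    (exists (E' : C) (i' : B' ~> E') (f' : E ~> E'), is_pushout f i i' f') /\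
    (forall (E' : C) (i' : B' ~> E') (f' : E ~> E'), is_pushout f i i' f' ->
       [/\ cof i', weq f -> weq f' & weq i -> weq i']).

Definition J3 : Prop :=
  forall (X Y : C) (f : X ~> Y),
    (exists (E : C) (tau : X ~> E) (p : E ~> Y), F_factorization f tau p) /\
    (exists (Z : C) (i : X ~> Z) (sigma : Z ~> Y), C_factorization f i sigma).

Definition J4 : Prop :=
  forall X : C, exists (X' : C) (q : X' ~> X),
    trivial_fib q /\ cofibrant_model X'.

(* The top face is the primed square, and a, b, c, d are the vertical maps. *)
Definition J5 : Prop :=
  forall (A B C' D At Bt Ct Dt : C)
    (u : D ~> C') (v : D ~> A) (g : C' ~> B) (f : A ~> B)
    (ut : Dt ~> Ct) (vt : Dt ~> At) (gt : Ct ~> Bt) (ft : At ~> Bt)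
    (a : At ~> A) (b : Bt ~> B) (c : Ct ~> C') (d : Dt ~> D),
    gt \o ut = ft \o vt ->
    homotopy_pushout u v g f ->
    homotopy_pullback ut d c u ->
    homotopy_pullback vt d a v ->
    homotopy_pullback gt c b g ->
    homotopy_pullback ft a b f ->
    homotopy_pushout ut vt gt ft.

(* j : W ~> B is a join morphism of f and g, for some choice of the
   factorizations, pullback and pushout involved in its construction. *)
Definition is_join (A B C' W : C) (f : A ~> B) (g : C' ~> B) (j : W ~> B)
    : Prop :=
  exists (E : C) (tau : C' ~> E) (p : E ~> B), F_factorization g tau p /\
  exists (E' : C) (p' : E' ~> A) (f' : E' ~> E), is_pullback f p p' f' /\
  exists (Z : C) (i : E' ~> Z) (sigma : Z ~> E), C_factorization f' i sigma /\
  exists (iA : A ~> W) (iZ : Z ~> W),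
    [/\ is_pushout p' i iA iZ, j \o iA = f & j \o iZ = p \o sigma].

Definition weak_lifting (A B C' : C) (f : A ~> B) (g : C' ~> B) : Prop :=
  exists (E : C) (tau : C' ~> E) (p : E ~> B),
    F_factorization g tau p /\ exists s : A ~> E, p \o s = f.

Definition weak_section (B C' : C) (g : C' ~> B) : Prop :=
  weak_lifting (idm B) g.

(* iterated_join p n h: for some choice of the successive joins, h is h_n. *)
Inductive iterated_join (E B : C) (p : E ~> B) :
    nat -> forall W : C, (W ~> B) -> Prop :=
| iterated_join0 : iterated_join p 0 p
| iterated_joinS n (W W' : C) (h : W ~> B) (h' : W' ~> B) :
    iterated_join p n h -> is_join h p h' -> iterated_join p n.+1 h'.

Definition weak_section_at (E B : C) (p : E ~> B) (n : nat) : Prop :=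
  exists (W : C) (h : W ~> B), iterated_join p n h /\ weak_section h.

(* Valued in the extended natural numbers, None being infinity. *)
Definition secat (E B : C) (p : E ~> B) : option nat :=
  match pselect (exists n, `[< weak_section_at p n >]) with
  | left ex_n => Some (ex_minn ex_n)
  | right _ => None
  end.

End ModelData.

Definition le_enat (m n : option nat) : bool :=
  match m, n with
  | _, None => true
  | None, Some _ => false
  | Some m', Some n' => m' <= n'
  end.

Record JCategory := {
  J_data :> modelData;
  J_zero : exists Z : J_data, is_zero Z;
  J_1 : J1 J_data;
  J_2_pullback : J2_pullback J_data;
  J_2_pushout : J2_pushout J_data;
  J_3 : J3 J_data;
  J_4 : J4 J_data;
  J_5 : J5 J_data }.

Definition modelization_functor (C D : modelData) (mu : functor C D) : Prop :=
  [/\ forall (X Y : C) (f : X ~> Y), weq f -> weq (fmap mu f),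
      forall (X C' A B : C) (d : X ~> C') (v : X ~> A) (g : C' ~> B)
        (f : A ~> B), homotopy_pullback d v g f ->
        homotopy_pullback (fmap mu d) (fmap mu v) (fmap mu g) (fmap mu f)
    & forall (X C' A B : C) (d : X ~> C') (v : X ~> A) (g : C' ~> B)
        (f : A ~> B), homotopy_pushout d v g f ->
        homotopy_pushout (fmap mu d) (fmap mu v) (fmap mu g) (fmap mu f)].

(* Main.v *)
Require Import Defs.
From mathcomp Require Import all_boot.
From mathcomp Require Import boolp.

(** Say that [f : A ~> B] is below [g : C ~> B] when [f] has a weak lifting
    along [g]. Since all objects are cofibrant models this is transitive, and
    [g] has a weak section iff the identity is below [g]; it therefore suffices
    to find, for every iterated join [h] of [p], an iterated join [k] of [mu p]
    of the same order with [mu h] below [k]. By induction [mu h] factors through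
    a replacement [kappa] of [k]. As [mu] preserves homotopy pushouts, the image
    of a join of [h] and [p] is weakly equivalent to a pushout
    [A <- F -> Z], where [F] maps to the pullback defining the join of [kappa]
    and [mu p]. No lifting axiom for cofibrations is available, so that [Z] is
    glued to the join of [kappa], which is then enlarged by a trivial
    cofibration: the result receives both the pushout and, by a weak
    equivalence, a join of [k] and [mu p]. *)

Set Implicit Arguments.
Unset Strict Implicit.
Unset Printing Implicit Defensive.

Local Open Scope cat_scope.

(** * Universal properties of pullbacks and pushouts *)

Section Universal.
Variable C : category.

Lemma pullback_lift (A B E P : C) (f : A ~> B) (p : E ~> B)
    (p1 : P ~> A) (p2 : P ~> E) : is_pullback f p p1 p2 ->
  forall (X : C) (x1 : X ~> A) (x2 : X ~> E), f \o x1 = p \o x2 ->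
  exists u : X ~> P, p1 \o u = x1 /\ p2 \o u = x2.
Proof. by move=> [_ univ] X x1 x2 /univ[u [uE _]]; exists u. Qed.

Lemma pullback_hom_eq (A B E P : C) (f : A ~> B) (p : E ~> B)
    (p1 : P ~> A) (p2 : P ~> E) : is_pullback f p p1 p2 ->
  forall (X : C) (u w : X ~> P), p1 \o u = p1 \o w -> p2 \o u = p2 \o w ->
  u = w.
Proof.
move=> [sq univ] X u w e1 e2.
have [|t [_ tU]] := univ X (p1 \o w) (p2 \o w); first by rewrite !comp_assoc sq.
by rewrite -(tU u) ?(tU w).
Qed.

Lemma pushout_desc (A D Z P : C) (f : D ~> A) (i : D ~> Z)
    (i1 : A ~> P) (i2 : Z ~> P) : is_pushout f i i1 i2 ->
  forall (X : C) (x1 : A ~> X) (x2 : Z ~> X), x1 \o f = x2 \o i ->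
  exists u : P ~> X, u \o i1 = x1 /\ u \o i2 = x2.
Proof. by move=> [_ univ] X x1 x2 /univ[u [uE _]]; exists u. Qed.

Lemma pushout_hom_eq (A D Z P : C) (f : D ~> A) (i : D ~> Z)
    (i1 : A ~> P) (i2 : Z ~> P) : is_pushout f i i1 i2 ->
  forall (X : C) (u w : P ~> X), u \o i1 = w \o i1 -> u \o i2 = w \o i2 ->
  u = w.
Proof.
move=> [sq univ] X u w e1 e2.
have [|t [_ tU]] := univ X (w \o i1) (w \o i2).
  by rewrite -!comp_assoc sq.
by rewrite -(tU u) ?(tU w).
Qed.

(** It allows the pullback that a join of [kappa \o tau] requires to be formed in two stages,
    through the one for [kappa]. *)
Lemma pullback_paste (A A' B E P P' : C) (f : A ~> B) (p : E ~> B)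
    (p1 : P ~> A) (p2 : P ~> E) (t : A' ~> A) (p1' : P' ~> A') (m : P' ~> P) :
  is_pullback f p p1 p2 -> is_pullback t p1 p1' m ->
  is_pullback (f \o t) p p1' (p2 \o m).
Proof.
move=> pb pb'; have [sq _] := pb; have [sq' _] := pb'; split.
  by rewrite -comp_assoc sq' comp_assoc sq comp_assoc.
move=> X x1 x2; rewrite -comp_assoc => /(pullback_lift pb)[u [u1 u2]].
have [w [w1 w2]] := pullback_lift pb' (esym u1).
exists w; split; first by rewrite -comp_assoc w2.
move=> w' [w1' w2']; apply: (pullback_hom_eq pb'); first by rewrite w1.
apply: (pullback_hom_eq pb); last by rewrite w2 u2 -w2' comp_assoc.
by rewrite w2 u1 comp_assoc -sq' -comp_assoc w1'.
Qed.

End Universal.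

(** * Weak liftings and their comparison with joins in a J-category *)

Section JCategory.
Variable C : JCategory.

Lemma weq_id (X : C) : weq (idm X).
Proof.
have [iso _ _ _] := J_1 C.
have [|[]//] := iso X X (idm X).
by exists (idm X); rewrite comp_idl.
Qed.

Lemma weq_comp (X Y Z : C) (g : Y ~> Z) (f : X ~> Y) :
  weq f -> weq g -> weq (g \o f).
Proof. by have [_ _ _ /(_ X Y Z g f)[]] := J_1 C. Qed.

Lemma weq_cancelr (X Y Z : C) (g : Y ~> Z) (f : X ~> Y) :
  weq f -> weq (g \o f) -> weq g.
Proof. by have [_ _ _ /(_ X Y Z g f)[]] := J_1 C. Qed.

Lemma weq_cancell (X Y Z : C) (g : Y ~> Z) (f : X ~> Y) :
  weq g -> weq (g \o f) -> weq f.
Proof. by have [_ _ _ /(_ X Y Z g f)[]] := J_1 C. Qed.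

Lemma fib_comp (X Y Z : C) (g : Y ~> Z) (f : X ~> Y) :
  fib g -> fib f -> fib (g \o f).
Proof. by have [_ fibM _ _] := J_1 C; apply: fibM. Qed.

Lemma cof_comp (X Y Z : C) (g : Y ~> Z) (f : X ~> Y) :
  cof g -> cof f -> cof (g \o f).
Proof. by have [_ _ cofM _] := J_1 C; apply: cofM. Qed.

Lemma F_factorization_exists (X Y : C) (f : X ~> Y) :
  exists (E : C) (tau : X ~> E) (p : E ~> Y), F_factorization f tau p.
Proof. by have [] := J_3 f. Qed.

Lemma C_factorization_exists (X Y : C) (f : X ~> Y) :
  exists (Z : C) (i : X ~> Z) (sigma : Z ~> Y), C_factorization f i sigma.
Proof. by have [] := J_3 f. Qed.

Lemma fib_pullback (E B B' : C) (f : B' ~> B) (p : E ~> B) : fib p ->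
  exists (E' : C) (p' : E' ~> B') (f' : E' ~> E),
    [/\ is_pullback f p p' f', fib p', weq f -> weq f' & weq p -> weq p'].
Proof.
move=> /(J_2_pullback f)[[E' [p' [f' pb]]] stable].
by exists E', p', f'; have [] := stable _ _ _ pb.
Qed.

Lemma cof_pushout (E B B' : C) (f : B ~> B') (i : B ~> E) : cof i ->
  exists (E' : C) (i' : B' ~> E') (f' : E ~> E'),
    [/\ is_pushout f i i' f', cof i', weq f -> weq f' & weq i -> weq i'].
Proof.
move=> /(J_2_pushout f)[[E' [i' [f' po]]] stable].
by exists E', i', f'; have [] := stable _ _ _ po.
Qed.

Lemma weak_lifting_refl (A B : C) (f : A ~> B) : weak_lifting f f.
Proof.
have [E [t [p fact]]] := F_factorization_exists f.
by exists E, t, p; split=> //; exists t; case: fact.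
Qed.

(** Precomposition with [w] turns an F-factorization of [g] into one of [g'] with the same
    fibration. *)
Lemma weak_lifting_weq (B X Y Y' : C) (f : X ~> B) (g : Y ~> B)
    (g' : Y' ~> B) (u : X ~> Y) (w : Y' ~> Y) :
  weq w -> g \o u = f -> g \o w = g' -> weak_lifting f g'.
Proof.
move=> weq_w gu gw; have [E [t [p [gE weq_t fib_p]]]] := F_factorization_exists g.
exists E, (t \o w), p; split; last by exists (t \o u); rewrite comp_assoc -gE.
by split=> //; [rewrite comp_assoc -gE | apply: weq_comp].
Qed.

Lemma weak_lifting_trans (B X Y Z : C) (f : X ~> B) (g : Y ~> B) (h : Z ~> B) :
  (forall A : C, cofibrant_model A) ->
  weak_lifting f g -> weak_lifting g h -> weak_lifting f h.
Proof.
move=> models [E [t [p [[gE weq_t fib_p] [s ps]]]]].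
move=> [E' [t' [p' [[hE weq_t' fib_p'] [s' ps']]]]].
have [P [p1 [p2 [pb fib_p1 _ _]]]] := fib_pullback p fib_p'.
have [|y [y1 y2]] := pullback_lift pb (x1 := t) (x2 := s').
  by rewrite -gE ps'.
(* As [p1 \o y = t] is a weak equivalence, [p1 \o q] will be a trivial fibration; its section over
   [E] carries [s] into [E']. *)
have [R [r [q [yE weq_r fib_q]]]] := F_factorization_exists y.
have [|x xE] := models E R (p1 \o q).
  split; first exact: fib_comp.
  by apply: (weq_cancelr weq_r); rewrite -comp_assoc -yE y1.
exists E', t', p'; split=> //; exists (p2 \o q \o x \o s).
have [sq _] := pb.
by rewrite !comp_assoc -sq -!comp_assoc (comp_assoc q) (comp_assoc p1)
  (comp_assoc p1) xE comp_idl.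
Qed.

(** The square on [F] is only assumed to commute, since [mu] need not preserve pullbacks; this
    already gives a map from [F] to the pullback [G] of [kappa] and [q]. *)
Lemma weak_lifting_join (A B Y K K' F Z Q P : C) (g : Y ~> B) (k : K ~> B)
    (kappa : K' ~> B) (tau : K ~> K') (s : A ~> K') (t : Y ~> Q) (q : Q ~> B)
    (v : F ~> A) (i : F ~> Z) (rho : Z ~> Q) (i1 : A ~> P) (i2 : Z ~> P)
    (j : P ~> B) :
  F_factorization g t q -> weq tau -> k = kappa \o tau ->
  cof i -> kappa \o s \o v = q \o rho \o i -> is_pushout v i i1 i2 ->
  j \o i1 = kappa \o s -> j \o i2 = q \o rho ->
  exists (W : C) (k' : W ~> B), is_join k g k' /\ weak_lifting j k'.
Proof.
move=> fact weq_tau kE cof_i sqF poP j1 j2; have [_ _ fib_q] := fact.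
(* The join of [kappa] is built on a pullback [G] and that of [k] on the
   weakly equivalent pullback [G0]. *)
have [G [a [b [pbG fib_a _ _]]]] := fib_pullback kappa fib_q.
have [G0 [a0 [m [pbG0 _ /(_ weq_tau) weq_m _]]]] := fib_pullback tau fib_a.
have [Z0 [c0 [sg0 fact0]]] := C_factorization_exists (b \o m).
have [bmE cof_c0 weq_sg0] := fact0.
have [W [iK [iZ [poW cof_iK _ _]]]] := cof_pushout a0 cof_c0.
have pbG' := pullback_paste pbG pbG0.
have [sqG _] := pbG; have [sqG0 _] := pbG0; have [sqG' _] := pbG'.
have [sqW _] := poW; have [sqP _] := poP.
have [|k' [k'K k'Z]] := pushout_desc poW (x1 := k) (x2 := q \o sg0).
  by rewrite kE sqG' -comp_assoc bmE.
exists W, k'; split.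
  exists Q, t, q; split=> //; exists G0, a0, (b \o m); split; first by rewrite kE.
  by exists Z0, c0, sg0; split=> //; exists iK, iZ.
(* Pushing out along [m] turns the factorization of [b \o m] through [Z0] into one of [b] through
   [T]. *)
have [T [e [z [poT _ /(_ weq_m) weq_z _]]]] := cof_pushout m cof_c0.
have [r [re rz]] := pushout_desc poT bmE.
have weq_r : weq r by apply: (weq_cancelr weq_z); rewrite rz.
(* [W2] is [W] with [K] replaced by [K'], the target of [s]; it plays the role of the join of
   [kappa]. *)
have [W2 [c [l [poW2 _ /(_ weq_tau) weq_l _]]]] := cof_pushout tau cof_iK.
have [sqW2 _] := poW2.
have [|y [ye yz]] := pushout_desc poT (x1 := c \o a) (x2 := l \o iZ).
  by rewrite -!comp_assoc -sqG0 -sqW !comp_assoc sqW2.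
have [|k2 [k2c k2l]] := pushout_desc poW2 (x1 := kappa) (x2 := k').
  by rewrite k'K kE.
have k2y : k2 \o y = q \o r.
  apply: (pushout_hom_eq poT); rewrite -!comp_assoc.
    by rewrite ye re comp_assoc k2c sqG.
  by rewrite yz rz comp_assoc k2l k'Z.
have [|n [an bn]] := pullback_lift pbG (x1 := s \o v) (x2 := rho \o i).
  by rewrite !comp_assoc.
(* Here [Z] is glued to [T] along [F]. *)
have [T3 [c3 [z3 [poT3 cof_c3 _ _]]]] := cof_pushout (e \o n) cof_i.
have [sqT3 _] := poT3.
have [|r3 [r3c r3z]] := pushout_desc poT3 (x1 := r) (x2 := rho).
  by rewrite comp_assoc re bn.
(* Enlarging [T3] to an object weakly equivalent to [Q], as [T] is, makes [T ~> T4] a trivial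
   cofibration, which is then pushed out along [y]. *)
have [T4 [c4 [sg4 [r3E cof_c4 weq_sg4]]]] := C_factorization_exists r3.
have cof_c43 : cof (c4 \o c3) by apply: cof_comp.
have weq_c43 : weq (c4 \o c3).
  by apply: (weq_cancell weq_sg4); rewrite comp_assoc -r3E r3c.
have [W3 [d [z4 [poW3 _ _ /(_ weq_c43) weq_d]]]] := cof_pushout y cof_c43.
have [sqW3 _] := poW3.
have [|k3 [k3d k3z]] := pushout_desc poW3 (x1 := k2) (x2 := q \o sg4).
  by rewrite k2y -r3c r3E -!comp_assoc.
have [|u [u1 u2]] :=
    pushout_desc poP (x1 := d \o c \o s) (x2 := z4 \o c4 \o z3).
  rewrite -!comp_assoc -an -sqT3 (comp_assoc c) -ye.
  by rewrite !comp_assoc sqW3 !comp_assoc.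
apply: (weak_lifting_weq (g := k3) (u := u) (w := d \o l)).
- exact: weq_comp.
- apply: (pushout_hom_eq poP); rewrite -comp_assoc.
    by rewrite u1 j1 !comp_assoc k3d k2c.
  by rewrite u2 j2 !comp_assoc k3z -r3z r3E !comp_assoc.
- by rewrite comp_assoc k3d.
Qed.

End JCategory.

(** * Images of joins under a modelization functor *)

Section Modelization.
Variables (C D : JCategory) (mu : functor C D).
Hypothesis hD : forall Y : D, cofibrant_model Y.
Hypothesis hmu : modelization_functor mu.

Lemma weak_lifting_fmap (A B Y : C) (f : A ~> B) (g : Y ~> B) :
  weak_lifting f g -> weak_lifting (fmap mu f) (fmap mu g).
Proof.
have [mu_weq _ _] := hmu.
move=> [E [t [p [[gE weq_t _] [s ps]]]]].
apply: (weak_lifting_weq (g := fmap mu p) (u := fmap mu s) (w := fmap mu t)).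
- exact: mu_weq.
- by rewrite -fmap_comp ps.
- by rewrite -fmap_comp -gE.
Qed.

Lemma fmap_join_weak_lifting (A B Y W : C) (K : D) (f : A ~> B) (g : Y ~> B)
    (j : W ~> B) (k : K ~> mu B) :
  is_join f g j -> weak_lifting (fmap mu f) k ->
  exists (W' : D) (k' : W' ~> mu B),
    is_join k (fmap mu g) k' /\ weak_lifting (fmap mu j) k'.
Proof.
have [mu_weq _ mu_hpo] := hmu.
move=> [E [t0 [p [[gE weq_t0 _] [E' [p' [f' [[sq _] [Z [i [sg]]]]]]]]]]].
move=> [[f'E cof_i _] [iA [iZ [po jA jZ]]]].
move=> [K' [tau [kappa [[kE weq_tau _] [s sE]]]]].
(* A pushout of a cofibration is a homotopy pushout, by the trivial C-factorization of [i]. *)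
have /mu_hpo[_ [Z' [i' [sg' [[iE cof_i' _]]]]]] : homotopy_pushout i p' iZ iA.
  have [sqW _] := po; split=> //.
  exists Z, i, (idm Z); split; first by split; rewrite ?comp_idl//; apply: weq_id.
  exists W, iA, iZ; split=> //; exists (idm W).
  by rewrite !comp_idl comp_idr; split=> //; apply: weq_id.
move=> [P [i1 [i2 [poP [w [w1 w2 weq_w]]]]]].
(* The image of the fibration [p] need not be a fibration, so it is factored again. *)
have [Q [t [q [pE weq_t fib_q]]]] := F_factorization_exists (fmap mu p).
have [|||||||//|W' [k' [joinK jk']]] := @weak_lifting_join D
  (mu A) (mu B) (mu Y) K K' (mu E') Z' Q P (fmap mu g) k kappa tau s
  (t \o fmap mu t0) q (fmap mu p') i' (t \o fmap mu sg \o sg') i1 i2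
  (fmap mu j \o w).
- split=> //; last by apply: weq_comp => //; apply: mu_weq.
  by rewrite comp_assoc -pE -fmap_comp -gE.
- by [].
- by [].
- by [].
- rewrite sE -fmap_comp sq !comp_assoc -pE -!comp_assoc -iE.
  by rewrite -!fmap_comp -f'E.
- by [].
- by rewrite -comp_assoc w1 -fmap_comp jA sE.
- by rewrite -comp_assoc w2 !comp_assoc -pE -!fmap_comp jZ.
exists W', k'; split=> //; apply: (weak_lifting_trans hD _ jk').
by apply: (weak_lifting_weq (g := fmap mu j) (u := idm _) weq_w); rewrite ?comp_idr.
Qed.

(** Induction on the joins: each step applies the one-join comparison to the [k] already found,
    starting from [fmap mu p] itself. *)
Lemma fmap_iterated_join_weak_lifting (E B : C) (p : E ~> B) n (W : C)
    (h : W ~> B) :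
  iterated_join p n h ->
  exists (W' : D) (k : W' ~> mu B),
    iterated_join (fmap mu p) n k /\ weak_lifting (fmap mu h) k.
Proof.
elim=> [|{}n {}W W1 {}h h1 _ [W' [k [joinK hk]]] joinH].
  exists (mu E), (fmap mu p).
  by split; [apply: iterated_join0 | apply: weak_lifting_refl].
have [W2 [k' [joinK' hk']]] := fmap_join_weak_lifting joinH hk.
by exists W2, k'; split=> //; apply: iterated_joinS joinK'.
Qed.

Lemma weak_section_at_fmap (E B : C) (p : E ~> B) n :
  weak_section_at p n -> weak_section_at (fmap mu p) n.
Proof.
move=> [W [h [/fmap_iterated_join_weak_lifting[W' [k [joinK hk]]]]]].
move=> /weak_lifting_fmap; rewrite fmap_id => idh.
by exists W', k; split=> //; apply: weak_lifting_trans idh hk.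
Qed.

End Modelization.

(** A larger set of integers has a smaller minimum, the empty set counting as infinity. *)
Lemma le_secat (C D : modelData) (E B : C) (p : E ~> B) (E' B' : D)
    (p' : E' ~> B') :
  (forall n, weak_section_at p n -> weak_section_at p' n) ->
  le_enat (secat p') (secat p).
Proof.
move=> sub; rewrite /secat.
case: pselect => [ex'|nex']; case: pselect => [ex|nex] //=.
  case: (ex_minnP ex) => n /asboolP/sub pn _.
  by case: (ex_minnP ex') => m _ -> //; apply/asboolP.
by case: nex'; case: ex => n /asboolP/sub pn; exists n; apply/asboolP.
Qed.

Theorem theorem23 (C D : JCategory)
    (hC : forall X : C, cofibrant_model X)
    (hD : forall Y : D, cofibrant_model Y)
    (mu : functor C D) (hmu : modelization_functor mu)
    (E B : C) (p : hom E B) :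
  le_enat (secat (fmap mu p)) (secat p).
Proof. by apply: le_secat => n; apply: weak_section_at_fmap. Qed.
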